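(* Let $(\bar x,\bar y)\in\mathrm{gph}\,S$. If the R-regularity constraint qualification (RRCQ) holds at $(\bar x,\bar y)$ and there are neighborhoods $U\subset\mathbb{R}^n$ of $\bar x$ and $V\subset\mathbb{R}^m$ of $\bar y$ such that $\mathrm{dom}\,K\cap(U\times V)=(\mathrm{dom}\,S\cap U)\times V$, then the local uniform weak sharp minimum condition (LUWSMC) is satisfied at $(\bar x,\bar y)$.
   Context: Data: $f_0:\mathbb{R}^n\times\mathbb{R}^m\to\mathbb{R}^m$ and $g_0:\mathbb{R}^n\times\mathbb{R}^m\times\mathbb{R}^m\to\mathbb{R}^q$ are continuously differentiable; inequalities between vectors are componentwise. The domain of a set-valued map is the set of points where its value is nonempty. $\mathbb{U}_r(\cdot)$ denotes the open ball of radius $r$ in the max-norm; $d(y,A)$ is the distance from $y$ to the set $A$. $K(x,y):=\{\varsigma\in\mathbb{R}^m\mid g_0(x,y,\varsigma)\le0\}$; $\varphi(x,y):=\min_\varsigma\{\varsigma^\top f_0(x,y)\mid\varsigma\in K(x,y)\}$. Put $g(x,y):=g_0(x,y,y)$ and $f(x,y):=y^\top f_0(x,y)$. The solution map of the parametric quasi-variational inequality is $S(x):=\{y\in K(x,y)\mid\langle f_0(x,y),\varsigma-y\rangle\ge0\ \forall\varsigma\in K(x,y)\}=\{y\in\mathbb{R}^m\mid g(x,y)\le0,\ f(x,y)-\varphi(x,y)\le0\}$. RRCQ at $(\bar x,\bar y)\in\mathrm{gph}\,S$: $S$ is R-regular at $(\bar x,\bar y)$ with respect to $\mathrm{dom}\,S$,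 i.e. there are $L,\epsilon,\delta>0$ such that $$d(y,S(x))\le L\max\Big\{0,\ \max_{j=1,\dots,q}g_j(x,y),\ f(x,y)-\varphi(x,y)\Big\}$$ for all $x\in\mathbb{U}_\delta(\bar x)\cap\mathrm{dom}\,S$ and $y\in\mathbb{U}_\epsilon(\bar y)$. LUWSMC at $(\bar x,\bar y)\in\mathrm{gph}\,S$: there exist $\alpha>0$ and $\varepsilon>0$ such that for all $(x,y)\in\mathbb{U}_\varepsilon(\bar x,\bar y)$: if $y\in K(x,y)$ then $d(y,S(x))\le\alpha\,(f(x,y)-\varphi(x,y))$. *)

(* Defs.v *)
From HB Require Import structures.
From mathcomp Require Import all_boot all_order all_algebra.
From mathcomp Require Import all_classical all_reals all_analysis.

Set Implicit Arguments.
Unset Strict Implicit.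
Unset Printing Implicit Defensive.

Import Order.TTheory GRing.Theory Num.Theory.
Import numFieldNormedType.Exports.

Local Open Scope classical_set_scope.
Local Open Scope ring_scope.

(* Norms on 'rV[R]_k and on products of such spaces are the library's, i.e.
   max-norms; [ball], [nbhs] and [edist_inf] are the ones they induce. In
   particular edist_inf A y is the distance from y to A as an element of
   \bar R, and it equals +oo when A is empty. *)

(* The second clause is the continuity of p |-> 'd F p for the operator norm,
   which the library does not provide. *)
Definition continuously_differentiable (R : realType)
    (V W : normedModType R) (F : V -> W) : Prop :=
  (forall p : V, differentiable F p) /\
  (forall (p : V) (e : R), 0 < e ->
     \forall p' \near p, forall v : V,
       `|'d F p' v - 'd F p v| <= e * `|v|).

Definition gph (X Y : Type) (M : X -> set Y) : set (X * Y) :=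
  [set p | M p.1 p.2].

Definition dom (X Y : Type) (M : X -> set Y) : set X := [set x | M x !=set0].

Definition dotv (R : realType) (m : nat) (u v : 'rV[R]_m) : R :=
  \sum_(i < m) u ord0 i * v ord0 i.

Section QVI.
Context {R : realType} {n m q : nat}.
Variable f0 : 'rV[R]_n * 'rV[R]_m -> 'rV[R]_m.
Variable g0 : 'rV[R]_n * 'rV[R]_m * 'rV[R]_m -> 'rV[R]_q.

Definition K (p : 'rV[R]_n * 'rV[R]_m) : set 'rV[R]_m :=
  [set s | forall j : 'I_q, g0 (p, s) ord0 j <= 0].

(* No attainment is assumed, so the value is an extended-real infimum:
   +oo if K p is empty, -oo if the objective is unbounded below on K p. *)
Definition phi (p : 'rV[R]_n * 'rV[R]_m) : \bar R :=
  ereal_inf [set (dotv s (f0 p))%:E | s in K p].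

Definition g (p : 'rV[R]_n * 'rV[R]_m) : 'rV[R]_q := g0 (p, p.2).

Definition f (p : 'rV[R]_n * 'rV[R]_m) : R := dotv p.2 (f0 p).

Definition S (x : 'rV[R]_n) : set 'rV[R]_m :=
  [set y | K (x, y) y /\
           forall s, K (x, y) s -> 0 <= dotv (f0 (x, y)) (s - y)].

Lemma S_value_function (x : 'rV[R]_n) :
  S x = [set y | (forall j : 'I_q, g (x, y) ord0 j <= 0) /\
                 ((f (x, y))%:E - phi (x, y) <= 0)%E].
Proof.
have dotE y s : dotv (f0 (x, y)) (s - y) = dotv s (f0 (x, y)) - f (x, y).
  rewrite /f /dotv -sumrB; apply: eq_bigr => i _.
  by rewrite !mxE mulrBr mulrC [X in _ - X]mulrC.
apply/seteqP; split=> y [Ky Hy]; split=> //.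
  rewrite sube_le0; apply: le_ereal_inf_tmp => _ [s Ks <-].
  by rewrite lee_fin -subr_ge0 -dotE; exact: Hy.
move=> s Ks; rewrite dotE subr_ge0 -lee_fin.
move: Hy; rewrite sube_le0 => /le_trans; apply.
by apply: ereal_inf_lbound; exists s.
Qed.

(* For q = 0 the inner maximum is that of the empty family, -oo. *)
Definition R_regular_wrt (D : set 'rV[R]_n) (xb : 'rV[R]_n) (yb : 'rV[R]_m)
    : Prop :=
  exists L eps delta : R, [/\ 0 < L, 0 < eps, 0 < delta &
    forall (x : 'rV[R]_n) (y : 'rV[R]_m),
      (ball xb delta `&` D) x -> ball yb eps y ->
      (edist_inf (S x) y <=
         L%:E * maxe 0 (maxe (\big[maxe/-oo]_(j < q) (g (x, y) ord0 j)%:E)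
                             ((f (x, y))%:E - phi (x, y))))%E].

Definition RRCQ (xb : 'rV[R]_n) (yb : 'rV[R]_m) : Prop :=
  R_regular_wrt (dom S) xb yb.

Definition LUWSMC (xb : 'rV[R]_n) (yb : 'rV[R]_m) : Prop :=
  exists alpha eps : R, [/\ 0 < alpha, 0 < eps &
    forall (x : 'rV[R]_n) (y : 'rV[R]_m),
      ball (xb, yb) eps (x, y) -> K (x, y) y ->
      (edist_inf (S x) y <= alpha%:E * ((f (x, y))%:E - phi (x, y)))%E].

End QVI.

(* Main.v *)
Require Import Defs.
From HB Require Import structures.
From mathcomp Require Import all_boot all_order all_algebra.
From mathcomp Require Import all_classical all_reals all_analysis.
Import numFieldNormedType.Exports.
Local Open Scope classical_set_scope.
Local Open Scope ring_scope.

Import Order.TTheory GRing.Theory Num.Theory.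

(** Whenever [y] lies in [K (x, y)], the residual that R-regularity bounds the
    distance by collapses to the gap [f - phi]: feasibility kills the part
    coming from [g] ([residual_at_feasible]), while [y] itself competes in the
    infimum defining [phi], so the gap is nonnegative ([value_gap_ge0]).
    Hence the R-regularity estimate is the weak sharp minimum estimate, except
    that it is only assumed for [x] in the domain of [S]. The domain condition
    removes this restriction: a [y] in [K (x, y)] makes [(x, y)] a point of
    the domain of [K], which near the reference point forces [x] into the
    domain of [S]. *)

(** Since [y] competes in the infimum, [phi (x, y)] is at most [f (x, y)]; it
    may be [-oo], making the gap [+oo], but it cannot be [+oo]. *)
Lemma value_gap_ge0 (R : realType) (n m q : nat)
    (f0 : 'rV[R]_n * 'rV[R]_m -> 'rV[R]_m)
    (g0 : 'rV[R]_n * 'rV[R]_m * 'rV[R]_m -> 'rV[R]_q)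
    (x : 'rV[R]_n) (y : 'rV[R]_m) :
  K g0 (x, y) y -> (0 <= (f f0 (x, y))%:E - phi f0 g0 (x, y))%E.
Proof.
move=> Ky; rewrite sube_ge0; last by rewrite orbT.
by apply: ereal_inf_lbound; exists y.
Qed.

Lemma residual_at_feasible (R : realType) (n m q : nat)
    (f0 : 'rV[R]_n * 'rV[R]_m -> 'rV[R]_m)
    (g0 : 'rV[R]_n * 'rV[R]_m * 'rV[R]_m -> 'rV[R]_q)
    (x : 'rV[R]_n) (y : 'rV[R]_m) :
  K g0 (x, y) y ->
  (maxe 0 (maxe (\big[maxe/-oo]_(j < q) (g g0 (x, y) ord0 j)%:E)
                ((f f0 (x, y))%:E - phi f0 g0 (x, y))) =
   (f f0 (x, y))%:E - phi f0 g0 (x, y))%E.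
Proof.
move=> Ky; have gap0 := value_gap_ge0 _ _ _ _ f0 _ _ _ Ky.
rewrite (@max_r _ _ (\big[maxe/-oo%E]_(j < q) _)) ?max_r //.
apply: le_trans gap0; apply: bigmax_le => [|j _]; first exact: leNye.
by rewrite lee_fin; exact: Ky.
Qed.

Theorem proposition4p1 (R : realType) (n m q : nat)
    (f0 : 'rV[R]_n * 'rV[R]_m -> 'rV[R]_m)
    (g0 : 'rV[R]_n * 'rV[R]_m * 'rV[R]_m -> 'rV[R]_q)
    (f0_C1 : continuously_differentiable f0)
    (g0_C1 : continuously_differentiable g0)
    (xb : 'rV[R]_n) (yb : 'rV[R]_m)
    (gphS : gph (S f0 g0) (xb, yb))
    (rrcq : RRCQ f0 g0 xb yb)
    (domKS : exists (U : set 'rV[R]_n) (V : set 'rV[R]_m),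
       [/\ nbhs xb U, nbhs yb V &
           dom (K g0) `&` (U `*` V) = (dom (S f0 g0) `&` U) `*` V]) :
  LUWSMC f0 g0 xb yb.
Proof.
have [U [V [/nbhs_ballP[rU /= rU0 subU] /nbhs_ballP[rV /= rV0 subV] domE]]] :=
  domKS.
have [L [eps [delta [L0 eps0 delta0 reg]]]] := rrcq.
exists L, (Num.min (Num.min rU rV) (Num.min eps delta)); split=> //.
  by rewrite !lt_min rU0 rV0 eps0 delta0.
move=> x y [/= bx by_] Ky.
have shrink r : Num.min (Num.min rU rV) (Num.min eps delta) <= r ->
    ball xb r x /\ ball yb r y.
  by move=> le_r; split; apply: le_ball le_r _ _.
have [bxU _] : ball xb rU x /\ ball yb rU y.
  by apply: shrink; rewrite !ge_min lexx.
have [_ byV] : ball xb rV x /\ ball yb rV y.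
  by apply: shrink; rewrite !ge_min lexx orbT.
have [_ byeps] : ball xb eps x /\ ball yb eps y.
  by apply: shrink; rewrite !ge_min lexx !orbT.
have [bxdelta _] : ball xb delta x /\ ball yb delta y.
  by apply: shrink; rewrite !ge_min lexx !orbT.
have [[domSx _] _] : ((dom (S f0 g0) `&` U) `*` V) (x, y).
  rewrite -domE; split; first by exists y.
  by split; [exact: subU|exact: subV].
by have := reg x y (conj bxdelta domSx) byeps; rewrite residual_at_feasible.
Qed.
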